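(* Let $a<b$ be real numbers and let $f:[a,b]\to\mathbb{R}$ be $\Phi$-uniformly convex, where $\Phi:[0,b-a]\to[0,\infty)$ is increasing with $\Phi(0)=0$. Let $p_i\ge 0$, $q_i>0$ for $i=1,2$, with $p_1+p_2=q_1+q_2=1$ and $\frac{p_1}{q_1}=m\le\frac{p_2}{q_2}$. Then $$p_1f(a)+p_2f(b)-f(p_1a+p_2b)-m\left(q_1f(a)+q_2f(b)-f(q_1a+q_2b)\right)$$ $$\ge m(p_2-mq_2)\Phi(q_1(b-a))=m(1-m)\Phi(q_1(b-a)).$$ In the special case $q_1=q_2=\frac12$, $$p_1f(a)+p_2f(b)-f(p_1a+p_2b)-2p_1\left[\frac{f(a)+f(b)}{2}-f\left(\frac{a+b}{2}\right)\right]\ge 2p_1(1-2p_1)\Phi\left(\frac{b-a}{2}\right),$$ and the maximum of the right-hand side of this last inequality (over the admissible values of $p_1$) is obtained when $p_1=\frac14$, in which case the inequality reads $$\frac14f(a)+\frac34f(b)-f\left(\frac14a+\frac34b\right)-\frac12\left(\frac{f(a)+f(b)}{2}-f\left(\frac{a+b}{2}\right)\right)\ge\frac14\Phi\left(\frac{b-a}{2}\right).$$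
   Context: A function $f:[a,b]\to\mathbb{R}$ is $\Phi$-uniformly convex, where $\Phi:[0,b-a]\to\mathbb{R}$ and $\Phi\ge 0$, if $tf(x)+(1-t)f(y)\ge f(tx+(1-t)y)+t(1-t)\Phi(|x-y|)$ for all $x,y\in[a,b]$ and $t\in[0,1]$. *)

(* Defs.v *)
From mathcomp Require Import all_boot all_order all_algebra.
From mathcomp Require Import reals.

Set Implicit Arguments.
Unset Strict Implicit.
Unset Printing Implicit Defensive.

Import Order.TTheory GRing.Theory Num.Theory.
Local Open Scope ring_scope.

(* Functions on an interval are total functions R -> R of which only the values
   on the interval are constrained: [a, b] for f and [0, b - a] for Phi. *)
Definition uniformly_convex (R : realType) (a b : R) (Phi f : R -> R) : Prop :=
  (forall z, z \in `[0, b - a] -> 0 <= Phi z) /\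
  (forall x y t, x \in `[a, b] -> y \in `[a, b] -> t \in `[0, 1] ->
     t * f x + (1 - t) * f y >=
     f (t * x + (1 - t) * y) + t * (1 - t) * Phi `|x - y|).

Definition admissible (R : realType) (p1 p2 q1 q2 : R) : Prop :=
  [/\ 0 <= p1 /\ 0 <= p2, 0 < q1 /\ 0 < q2,
      p1 + p2 = 1, q1 + q2 = 1 & p1 / q1 <= p2 / q2].

(* Main.v *)
(* Since p1 = m q1, the point p1 a + p2 b equals m c + (1 - m) b with
   c = q1 a + q2 b. Uniform convexity at c and b with weight m in [0, 1] gives
   the first inequality, because |c - b| = q1 (b - a) and p2 - m q2 = 1 - m.
   The remaining claims are its instances at q1 = q2 = 1/2, together with
   2 p (1 - 2 p) <= 1/4. *)
Require Import Defs.
From mathcomp Require Import all_boot all_order all_algebra.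
From mathcomp Require Import reals.
From mathcomp Require Import ring lra.
Import Order.TTheory GRing.Theory Num.Theory.
Local Open Scope ring_scope.

(** Cross-multiplying the ratios gives [p1 * q2 <= p2 * q1]; since both pairs sum to 1, this reads
    [p1 * (1 - q1) <= (1 - p1) * q1], that is [p1 <= q1]. It makes the ratio a legitimate convexity
    weight. *)
Lemma admissible_ratio (R : realType) (p1 p2 q1 q2 : R) :
  admissible p1 p2 q1 q2 -> 0 <= p1 / q1 <= 1.
Proof.
case=> -[p1_ge0 p2_ge0] [q1_gt0 q2_gt0] p12 q12.
rewrite ler_pdivrMr // mulrAC ler_pdivlMr // => le_pq.
rewrite divr_ge0 ?(ltW q1_gt0) //= ler_pdivrMr //; nra.
Qed.

Lemma uniformly_convex_jensen_gap (R : realType) (a b : R) (Phi f : R -> R)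
    (p1 p2 q1 q2 : R) (m := p1 / q1) :
  a < b -> uniformly_convex a b Phi f -> admissible p1 p2 q1 q2 ->
  m * (1 - m) * Phi (q1 * (b - a)) <=
    p1 * f a + p2 * f b - f (p1 * a + p2 * b)
      - m * (q1 * f a + q2 * f b - f (q1 * a + q2 * b)).
Proof.
move=> lt_ab [_ f_cvx] adm.
have m01 : m \in `[0, 1] by rewrite in_itv; exact: admissible_ratio adm.
case: adm => _ [q1_gt0 q2_gt0] p12 q12 _.
have p1E : p1 = m * q1 by rewrite divfK ?gt_eqF.
have p2E : p2 = 1 - m * q1 by lra.
have q2E : q2 = 1 - q1 by lra.
(* While the body of [m] mentions [p1], the equation [p1 = m * q1] is circular; forgetting it lets
   [subst] remove [p1] and leaves division-free goals in [m] and [q1]. *)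
clearbody m; subst p1 p2 q2.
set c := q1 * a + (1 - q1) * b.
have c_ab : c \in `[a, b] by rewrite in_itv /= /c; apply/andP; split; nra.
have b_ab : b \in `[a, b] by rewrite in_itv /= lexx ltW.
have distE : `|c - b| = q1 * (b - a).
  by rewrite ler0_norm /c; [ring | nra].
have := f_cvx c b m c_ab b_ab m01; rewrite distE.
have -> : m * c + (1 - m) * b = m * q1 * a + (1 - m * q1) * b by rewrite /c; ring.
(* In the claim the [f a] terms cancel and [f b] keeps the coefficient [1 - m], which is exactly the
   convexity inequality. *)
lra.
Qed.

Theorem theorem9 (R : realType) (a b : R) (f Phi : R -> R)
  (hab : a < b)
  (Phi0 : Phi 0 = 0)
  (Phi_incr : {in `[0, b - a] &, {homo Phi : x y / x <= y}})
  (hf : uniformly_convex a b Phi f) :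
  (forall p1 p2 q1 q2 m : R, admissible p1 p2 q1 q2 -> p1 / q1 = m ->
     p1 * f a + p2 * f b - f (p1 * a + p2 * b)
       - m * (q1 * f a + q2 * f b - f (q1 * a + q2 * b))
     >= m * (p2 - m * q2) * Phi (q1 * (b - a))
     /\ m * (p2 - m * q2) * Phi (q1 * (b - a))
        = m * (1 - m) * Phi (q1 * (b - a)))
  /\ (forall p1 p2 : R, admissible p1 p2 (1 / 2) (1 / 2) ->
     p1 * f a + p2 * f b - f (p1 * a + p2 * b)
       - 2 * p1 * ((f a + f b) / 2 - f ((a + b) / 2))
     >= 2 * p1 * (1 - 2 * p1) * Phi ((b - a) / 2))
  /\ (admissible (1 / 4) (3 / 4) (1 / 2) (1 / 2 : R) /\
      forall p1 p2 : R, admissible p1 p2 (1 / 2) (1 / 2) ->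
        2 * p1 * (1 - 2 * p1) * Phi ((b - a) / 2)
        <= 2 * (1 / 4) * (1 - 2 * (1 / 4)) * Phi ((b - a) / 2))
  /\ 1 / 4 * f a + 3 / 4 * f b - f (1 / 4 * a + 3 / 4 * b)
       - 1 / 2 * ((f a + f b) / 2 - f ((a + b) / 2))
     >= 1 / 4 * Phi ((b - a) / 2).
Proof.
have gap := @uniformly_convex_jensen_gap R a b Phi f _ _ _ _ hab hf.
have half_gap p1 p2 (adm : admissible p1 p2 (1 / 2) (1 / 2)) :
    2 * p1 * (1 - 2 * p1) * Phi ((b - a) / 2) <=
    p1 * f a + p2 * f b - f (p1 * a + p2 * b)
      - 2 * p1 * ((f a + f b) / 2 - f ((a + b) / 2)).
  have := gap _ _ _ _ adm.
  have -> : p1 / (1 / 2) = 2 * p1 by field.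
  have -> : 1 / 2 * (b - a) = (b - a) / 2 by ring.
  have -> : 1 / 2 * a + 1 / 2 * b = (a + b) / 2 by ring.
  by have -> : 1 / 2 * f a + 1 / 2 * f b = (f a + f b) / 2 by ring.
(* The ratios are 1/2 and 3/2, so the maximum is attained at an admissible point. *)
have adm14 : admissible (1 / 4) (3 / 4) (1 / 2) (1 / 2 : R).
  by split; [split | split | | |]; lra.
split.
  move=> p1 p2 q1 q2 m adm mE.
  have p2E : p2 - m * q2 = 1 - m.
    case: (adm) => _ [q1_gt0 _] p12 q12 _.
    have p1E : p1 = m * q1 by rewrite -mE divfK ?gt_eqF.
    have -> : p2 = 1 - m * q1 by lra.
    have -> : q2 = 1 - q1 by lra.
    ring.
  by rewrite p2E; split=> //; rewrite -mE; exact: gap.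
split; first exact: half_gap.
split.
  split=> // p1 p2 _; apply: ler_wpM2r; last first.
    (* Completing the square: [1 / 4 - 2 * p1 * (1 - 2 * p1)] equals [(4 * p1 - 1) ^+ 2 / 4]. *)
    by have := sqr_ge0 (4 * p1 - 1); nra.
  by apply: hf.1; rewrite in_itv /=; apply/andP; split; lra.
have := half_gap _ _ adm14.
have -> : 2 * (1 / 4) = 1 / 2 :> R by field.
by have -> : 1 / 2 * (1 - 1 / 2) = 1 / 4 :> R by field.
Qed.
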